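(* Let $E$ be a connected graded Frobenius algebra with Nakayama automorphism $\mu_E$, and let $K$ be a Hopf algebra with antipode $S$ such that $E$ is a left $K$-comodule algebra with grading-preserving coaction $\rho$ whose restriction to $E_1$ is inner-faithful. Let ${\sf D}\in K$ be the homological codeterminant. Choose a basis $\{a_i\}_{i=1}^n$ of $E_1$, let $\alpha=(\alpha_{ij})$ be given by $\mu_E(a_i)=\sum_j\alpha_{ij}a_j$, and write $\rho(a_i)=\sum_s y_{is}\otimes a_s$, $\mathbb Y=(y_{ij})$. Then the assignment $\mathbb Y\mapsto\alpha\mathbb Y\alpha^{-1}$ (i.e. $y_{ij}\mapsto(\alpha\mathbb Y\alpha^{-1})_{ij}$) extends to a unique Hopf algebra endomorphism $\eta_{\mu_E}$ of $K$, which satisfies $\eta_{\mu_E}(y_{ij})={\sf D}^{-1}S^2(y_{ij}){\sf D}$ for all $i,j$ and in fact $\eta_{\mu_E}=\eta_{\sf D}\circ S^2$ on $K$, where $\eta_{\sf D}(a)={\sf D}^{-1}a{\sf D}$. Consequently $S$ is surjective (and $\eta_{\mu_E}$ does not depend on the choice of basis).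
   Context: A connected graded algebra $E$ is Frobenius if it is finite dimensional with a nondegenerate associative graded bilinear form $\langle-,-\rangle$; its (classical) Nakayama automorphism $\mu_E$ is the graded automorphism with $\langle a,b\rangle=\langle b,\mu_E(a)\rangle$. The top nonzero degree $E_l$ is one-dimensional, spanned by $\mathfrak e$; the homological codeterminant is the grouplike ${\sf D}\in K$ with $\rho(\mathfrak e)={\sf D}\otimes\mathfrak e$. The left coaction on $E_1$ is inner-faithful if $\rho(E_1)\not\subseteq K'\otimes E_1$ for every proper Hopf subalgebra $K'\subsetneq K$. *)

(* Defs.v *)
From HB Require Import structures.
From mathcomp Require Import all_boot all_order all_algebra all_field.
Set Implicit Arguments. Unset Strict Implicit. Unset Printing Implicit Defensive.
Import GRing.Theory.
Local Open Scope ring_scope.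

Section Defs.
Variable k : fieldType.

Definition bilinear (U V W : lmodType k) (f : U -> V -> W) : Prop :=
  (forall u, linear (f u)) /\ (forall v, linear (fun u => f u v)).

(* A tensor product U (x) V over k, given by its universal property.
   [tlift f] is the linear map induced by a bilinear map f (junk if f is
   not bilinear). *)
Record tensor (U V : lmodType k) := Tensor {
  tcar : lmodType k;
  tmul : U -> V -> tcar;
  tlift : forall X : lmodType k, (U -> V -> X) -> tcar -> X;
  tmul_bilinear : bilinear tmul;
  tlift_spec : forall (X : lmodType k) (f : U -> V -> X), bilinear f ->
     linear (tlift f) /\ (forall u v, tlift f (tmul u v) = f u v);
  tlift_uniq : forall (X : lmodType k) (f : U -> V -> X) (g : tcar -> X),
     linear g -> (forall u v, g (tmul u v) = f u v) ->
     forall x, g x = tlift f x }.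
Arguments tlift {U V} t {X}.
Arguments tmul {U V} t.

Definition tmap (U V U' V' : lmodType k) (T : tensor U V) (T' : tensor U' V')
  (f : U -> U') (g : V -> V') : tcar T -> tcar T' :=
  tlift T (fun u v => tmul T' (f u) (g v)).
Arguments tmap {U V U' V'} T T' f g _.

Definition tprod (A B : lalgType k) (T : tensor A B) (x y : tcar T) : tcar T :=
  tlift T (fun a b => tlift T (fun a' b' => tmul T (a * a') (b * b')) y) x.
Arguments tprod {A B} T x y.

Definition in_tspan (U V : lmodType k) (T : tensor U V)
  (P : U -> Prop) (Q : V -> Prop) (x : tcar T) : Prop :=
  exists s : seq (U * V), {in s, forall p, P p.1 /\ Q p.2} /\
     x = \sum_(p <- s) tmul T p.1 p.2.
Arguments in_tspan {U V} T P Q x.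

Section Hopf.
Variables (K : algType k) (TKK : tensor K K) (TKKK : tensor (tcar TKK) K).
Variables (Delta : K -> tcar TKK) (eps : K -> k) (S : K -> K).

Definition Delta_id (x : tcar TKK) : tcar TKKK :=
  tlift TKK (fun u v => tmul TKKK (Delta u) v) x.
Definition id_Delta (x : tcar TKK) : tcar TKKK :=
  tlift TKK (fun u v => tlift TKK (fun v1 v2 => tmul TKKK (tmul TKK u v1) v2)
                                 (Delta v)) x.

Definition is_hopf : Prop :=
  [/\ linear Delta /\ Delta 1 = tmul TKK 1 1 /\
        (forall a b, Delta (a * b) = tprod TKK (Delta a) (Delta b)),
      scalar eps /\ eps 1 = 1 /\ (forall a b, eps (a * b) = eps a * eps b),
      (forall a, Delta_id (Delta a) = id_Delta (Delta a)),
      (forall a, tlift TKK (fun u v => eps u *: v) (Delta a) = a /\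
                 tlift TKK (fun u v => eps v *: u) (Delta a) = a)
    & linear S /\
      (forall a, tlift TKK (fun u v => S u * v) (Delta a) = (eps a)%:A /\
                 tlift TKK (fun u v => u * S v) (Delta a) = (eps a)%:A)].

(* Hopf algebra (= bialgebra) endomorphism of K *)
Definition hopf_endo (eta : K -> K) : Prop :=
  [/\ linear eta, eta 1 = 1, (forall a b, eta (a * b) = eta a * eta b),
      (forall a, Delta (eta a) = tmap TKK TKK eta eta (Delta a))
    & (forall a, eps (eta a) = eps a)].

Definition hopf_subalg (P : K -> Prop) : Prop :=
  [/\ P 0, (forall (c : k) x y, P x -> P y -> P (c *: x + y)),
      P 1 /\ (forall x y, P x -> P y -> P (x * y)),
      (forall x, P x -> in_tspan TKK P P (Delta x))
    & (forall x, P x -> P (S x))].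

Definition proper_pred (P : K -> Prop) : Prop := exists x, ~ P x.

End Hopf.
Arguments hopf_subalg {K} TKK Delta S P.

Section Graded.
Variable E : falgType k.

Definition connected_graded (Eg : nat -> {vspace E}) : Prop :=
  [/\ exists N : nat, [/\ (forall i, (N <= i)%N -> Eg i = 0%VS),
                          (\sum_(i < N) Eg i)%VS = fullv
                        & directv (\sum_(i < N) Eg i)],
      (forall i j x y, x \in Eg i -> y \in Eg j -> x * y \in Eg (i + j)%N)
    & Eg 0%N = <[1 : E]>%VS].

Definition top_degree (Eg : nat -> {vspace E}) (l : nat) : Prop :=
  Eg l != 0%VS /\ (forall i, (l < i)%N -> Eg i = 0%VS).

Definition frobenius_form (Eg : nat -> {vspace E}) (l : nat)
  (form : E -> E -> k) : Prop :=
  [/\ (forall a, scalar (form a)) /\ (forall b, scalar (fun a => form a b)),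
      (forall a b c, form (a * b) c = form a (b * c)),
      (forall a, (forall b, form a b = 0) -> a = 0) /\
      (forall b, (forall a, form a b = 0) -> b = 0)
    & (forall i j x y, x \in Eg i -> y \in Eg j -> (i + j)%N != l ->
         form x y = 0)].

Definition nakayama (Eg : nat -> {vspace E}) (form : E -> E -> k)
  (mu : E -> E) : Prop :=
  [/\ linear mu /\ bijective mu,
      mu 1 = 1 /\ (forall a b, mu (a * b) = mu a * mu b),
      (forall i x, x \in Eg i -> mu x \in Eg i)
    & (forall a b, form a b = form b (mu a))].

End Graded.

Section Comodule.
Variables (K : algType k) (E : falgType k).
Variables (TKK : tensor K K) (TKE : tensor K E) (TKKE : tensor (tcar TKK) E).
Variables (Delta : K -> tcar TKK) (eps : K -> k) (rho : E -> tcar TKE).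

Definition comodule_algebra : Prop :=
  [/\ linear rho, rho 1 = tmul TKE 1 1,
      (forall a b, rho (a * b) = tprod TKE (rho a) (rho b)),
      (forall x, tlift TKE (fun u e => tmul TKKE (Delta u) e) (rho x) =
                 tlift TKE (fun u e => tlift TKE
                     (fun u' e' => tmul TKKE (tmul TKK u u') e') (rho e)) (rho x))
    & (forall x, tlift TKE (fun u e => eps u *: e) (rho x) = x)].

Definition grading_preserving (Eg : nat -> {vspace E}) : Prop :=
  forall i x, x \in Eg i ->
    in_tspan TKE (fun _ => True) (fun e => e \in Eg i) (rho x).

End Comodule.

Definition inner_faithful_E1 (K : algType k) (E : falgType k)
  (TKK : tensor K K) (TKE : tensor K E) (Delta : K -> tcar TKK) (S : K -> K)
  (rho : E -> tcar TKE) (E1 : {vspace E}) : Prop :=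
  forall P : K -> Prop, hopf_subalg TKK Delta S P -> proper_pred P ->
    ~ (forall e, e \in E1 -> in_tspan TKE P (fun e' => e' \in E1) (rho e)).

End Defs.

(* Main.v *)
(** Contracting the coaction with the Frobenius form, [(id (x) <1,->) rho(x) =
    <1,x> D], turns the coefficients of [rho] on a family of [E] dual to
    [a_1, ..., a_n] into a matrix [W] with [Y W^T = D]; the defining property of
    the Nakayama automorphism gives in the same way a relation between [W] and
    [Y' = alpha Y alpha^-1]. Since [S(Y) = Y^-1], eliminating [W] leaves
    [D Y' = S^2(Y) D]. As [D] is grouplike, [eta(x) = D^-1 S^2(x) D] is a Hopf
    endomorphism with [eta(Y) = Y']. By inner-faithfulness [K] is generated as
    an algebra by the [S^m(y_ij)], which gives uniqueness and, as every [y_ij]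
    is in the image of [eta] and [eta S = S eta], surjectivity of [eta] and
    hence of [S]. *)

Require Import Defs.
From HB Require Import structures.
From mathcomp Require Import all_boot all_order all_algebra all_field.
From Stdlib Require Import Classical.
Set Implicit Arguments.
Unset Strict Implicit.
Unset Printing Implicit Defensive.
Import GRing.Theory.
Local Open Scope ring_scope.

(** * Linear maps and the universal property of tensor products *)

Section Linear.
Variable k : fieldType.
Implicit Types U V W X Y : lmodType k.

Lemma linear_idfun U : linear (fun x : U => x).
Proof. by []. Qed.

Lemma linear_compose U V W (g : V -> W) (f : U -> V) :
  linear g -> linear f -> linear (fun x => g (f x)).
Proof. by move=> Hg Hf c u v; rewrite Hf Hg. Qed.

Lemma scalar_compose U V (s : V -> k) (f : U -> V) :
  scalar s -> linear f -> scalar (fun x => s (f x)).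
Proof. by move=> Hs Hf c u v; rewrite Hf Hs. Qed.

Lemma linear_scaler U V (c : k) (f : U -> V) :
  linear f -> linear (fun x => c *: f x).
Proof. by move=> Hf d u v; rewrite Hf scalerDr !scalerA mulrC. Qed.

Lemma linear_scalel U V (s : U -> k) (b : V) :
  scalar s -> linear (fun x => s x *: b).
Proof. by move=> Hs d u v; rewrite Hs scalerDl scalerA. Qed.

Lemma linear_mull U (A : lalgType k) (f : U -> A) (b : A) :
  linear f -> linear (fun x => f x * b).
Proof. by move=> Hf d u v; rewrite Hf mulrDl scalerAl. Qed.

Lemma linear_mulr U (A : algType k) (f : U -> A) (b : A) :
  linear f -> linear (fun x => b * f x).
Proof. by move=> Hf d u v; rewrite Hf mulrDr scalerAr. Qed.

Lemma linear_add U V (f g : U -> V) :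
  linear f -> linear g -> linear (fun x => f x + g x).
Proof.
by move=> Hf Hg c u v; rewrite Hf Hg scalerDr addrACA.
Qed.

Section LinearProp.
Variables (U V : lmodType k) (f : U -> V).
Hypothesis Hf : linear f.

Lemma linear_prop0 : f 0 = 0.
Proof.
by have := Hf (-1) 0 0; rewrite scaler0 add0r scaleN1r addNr.
Qed.

Lemma linear_propD : {morph f : x y / x + y}.
Proof. by move=> x y; have := Hf 1 x y; rewrite !scale1r. Qed.

Lemma linear_propZ c : {morph f : x / c *: x}.
Proof. by move=> x; have := Hf c x 0; rewrite !addr0 linear_prop0 addr0. Qed.

Lemma linear_prop_sum I (r : seq I) (P : pred I) (F : I -> U) :
  f (\sum_(i <- r | P i) F i) = \sum_(i <- r | P i) f (F i).
Proof. exact: (big_morph f linear_propD linear_prop0). Qed.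
End LinearProp.

Section Tensor.
Variables (U V : lmodType k) (T : tensor U V).

Lemma tmul_linearl W (f : W -> U) (v : V) :
  linear f -> linear (fun x => tmul T (f x) v).
Proof.
by move=> Hf c x y; rewrite Hf; have [_ /(_ v) H] := tmul_bilinear T; apply: H.
Qed.

Lemma tmul_linearr W (f : W -> V) (u : U) :
  linear f -> linear (fun x => tmul T u (f x)).
Proof.
by move=> Hf c x y; rewrite Hf; have [/(_ u) H _] := tmul_bilinear T; apply: H.
Qed.

Lemma tlift_linear X (phi : U -> V -> X) :
  Defs.bilinear phi -> linear (tlift (t := T) phi).
Proof. by move=> /(tlift_spec T)[]. Qed.

Lemma tliftE X (phi : U -> V -> X) u v :
  Defs.bilinear phi -> tlift phi (tmul T u v) = phi u v.
Proof. by move=> /(tlift_spec T)[]. Qed.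

Lemma tensor_ext X (f g : tcar T -> X) : linear f -> linear g ->
  (forall u v, f (tmul T u v) = g (tmul T u v)) -> f =1 g.
Proof.
move=> Hf Hg fg x; rewrite (tlift_uniq Hf fg).
by rewrite (tlift_uniq (f := fun u v => g (tmul T u v)) Hg).
Qed.

(** Uniqueness of the lift allows rewriting under a Sweedler sum from pointwise equality, without
    functional extensionality. *)
Lemma eq_tlift X (phi psi : U -> V -> X) (x : tcar T) :
  Defs.bilinear phi -> (forall u v, phi u v = psi u v) ->
  tlift phi x = tlift psi x.
Proof.
move=> Hphi e; apply: tlift_uniq; first exact: tlift_linear.
by move=> u v; rewrite tliftE.
Qed.

Lemma tlift_comp X Y (h : X -> Y) (phi : U -> V -> X) (x : tcar T) :
  linear h -> Defs.bilinear phi ->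
  h (tlift phi x) = tlift (fun u v => h (phi u v)) x.
Proof.
move=> Hh Hphi; apply: (tlift_uniq (g := fun x => h (tlift phi x))).
  by apply: linear_compose => //; apply: tlift_linear.
by move=> u v; rewrite tliftE.
Qed.

(** Both sides of the linearity equation are linear in [t], so pure tensors suffice. This is what
    makes nested Sweedler sums multilinear. *)
Lemma tlift_linear_param W X (Phi : W -> U -> V -> X) (t : tcar T) :
  (forall w, Defs.bilinear (Phi w)) ->
  (forall u v, linear (fun w => Phi w u v)) ->
  linear (fun w => tlift (Phi w) t).
Proof.
move=> HPhi Hw c w w'; apply: (tensor_ext
  (g := fun t => c *: tlift (Phi w) t + tlift (Phi w') t)).
- exact: tlift_linear.
- by apply: linear_add; [apply: linear_scaler|]; apply: tlift_linear.
- by move=> u v; rewrite !tliftE //; apply: Hw.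
Qed.

End Tensor.

(** Fubini for two independent Sweedler sums, checked on pure tensors in [x]. *)
Lemma tlift_exchange U V U' V' X (T : tensor U V) (T' : tensor U' V')
    (Phi : U -> V -> U' -> V' -> X) (x : tcar T) (y : tcar T') :
  (forall v u' v', linear (fun u => Phi u v u' v')) ->
  (forall u u' v', linear (fun v => Phi u v u' v')) ->
  (forall u v v', linear (fun u' => Phi u v u' v')) ->
  (forall u v u', linear (fun v' => Phi u v u' v')) ->
  tlift (fun u v => tlift (fun u' v' => Phi u v u' v') y) x =
  tlift (fun u' v' => tlift (fun u v => Phi u v u' v') x) y.
Proof.
move=> H1 H2 H3 H4.
have B1 u v : Defs.bilinear (Phi u v) by [].
have B2 u' v' : Defs.bilinear (fun u v => Phi u v u' v') by [].
have B3 y' : Defs.bilinear (fun u v => tlift (t := T') (Phi u v) y').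
  by split=> ?; apply: tlift_linear_param.
apply: (tensor_ext (g := fun x =>
  tlift (fun u' v' => tlift (fun u v => Phi u v u' v') x) y)).
- exact: tlift_linear.
- apply: tlift_linear_param => [x'|u' v']; last exact: tlift_linear.
  by split=> ?; apply: tlift_linear_param.
move=> u v; rewrite tliftE //; apply: eq_tlift => // u' v'.
by rewrite tliftE.
Qed.

(** * Bilinearity of the product on a tensor product of algebras *)

Section TensorProd.
Variables (A B : algType k) (T : tensor A B).

Lemma tprod_inner_bilinear a b :
  Defs.bilinear (fun a' b' => tmul T (a * a') (b * b')).
Proof.
by split=> ?; [apply: tmul_linearr|apply: tmul_linearl]; apply: linear_mulr.
Qed.

Lemma tprod_outer_bilinear (y : tcar T) : Defs.bilinear
  (fun a b => tlift (fun a' b' => tmul T (a * a') (b * b')) y).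
Proof.
by split=> ?; (apply: tlift_linear_param => *; first exact: tprod_inner_bilinear);
  [apply: tmul_linearr|apply: tmul_linearl]; apply: linear_mull.
Qed.

Lemma tprod_linearl W (f : W -> tcar T) y :
  linear f -> linear (fun x => tprod (f x) y).
Proof.
by apply: linear_compose; apply: tlift_linear; apply: tprod_outer_bilinear.
Qed.

Lemma tprod_linearr W (f : W -> tcar T) x :
  linear f -> linear (fun y => tprod x (f y)).
Proof.
move=> Hf; apply: tlift_linear_param => [w|a b].
  exact: tprod_outer_bilinear.
by apply: linear_compose => //; apply: tlift_linear; apply: tprod_inner_bilinear.
Qed.

End TensorProd.
End Linear.

(** * Automatic proofs of linearity and bilinearity *)

Ltac lin_step :=
  match goal with
  | |- Defs.bilinear _ => split; intro
  | |- GRing.linear_for _ (fun x => x) => apply: linear_idfun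
  | |- GRing.linear_for _ (fun x => tmul _ ?u _) => apply: tmul_linearr
  | |- GRing.linear_for _ (fun x => tmul _ _ ?v) => apply: tmul_linearl
  | |- GRing.linear_for _ (fun x => tprod ?y _) => apply: tprod_linearr
  | |- GRing.linear_for _ (fun x => tprod _ ?y) => apply: tprod_linearl
  | |- GRing.linear_for _ (fun x => @GRing.mul _ ?b _) => apply: linear_mulr
  | |- GRing.linear_for _ (fun x => @GRing.mul _ _ ?b) => apply: linear_mull
  | |- GRing.linear_for _ (fun x => @GRing.scale _ _ ?c _) => apply: linear_scaler
  | |- GRing.linear_for _ (fun x => @GRing.scale _ _ _ ?b) => apply: linear_scalel
  | |- GRing.linear_for _ (fun x => tlift ?phi x) => apply: tlift_linear
  | |- GRing.linear_for _ (fun x => tlift ?phi (@?h x)) =>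
      apply: (@linear_compose _ _ _ _ (tlift phi) h)
  | |- GRing.linear_for _ (fun x => tlift _ ?t) => apply: tlift_linear_param
  (* A bare application is left to the hypotheses: the composition rule below would match it with
     [h] the identity and loop. *)
  | |- GRing.linear_for _ (fun x => ?F x) => fail 1
  | |- GRing.linear_for _ (fun x => ?F (@?h x)) =>
      first [ apply: (@linear_compose _ _ _ _ F h)
            | apply: (@scalar_compose _ _ _ F h) ]
  | |- GRing.linear_for _ (fun x => ?F (@?h x) ?y) =>
      apply: (@linear_compose _ _ _ _ (fun z => F z y) h)
  | |- forall _, _ => intro
  end.

(* The functions are eta-expanded first, since [lin_step] matches on their
   bodies. *)
Ltac lin :=
  cbv beta;
  first [ solve [eauto]
        | lazymatch goal with
          | |- GRing.linear_for _ (fun _ => _) => idtac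
          | |- GRing.linear_for ?s ?f => change (GRing.linear_for s (fun x => f x))
          | |- _ => idtac
          end; cbv beta; lin_step; lin ].

(** * Algebra laws in a tensor product, and spans of pure tensors *)

Section TensorAlgebra.
Variables (k : fieldType) (A B : algType k) (T : tensor A B).

Lemma tprodE a b a' b' :
  tprod (tmul T a b) (tmul T a' b') = tmul T (a * a') (b * b').
Proof. by rewrite /tprod !tliftE //; lin. Qed.

Lemma tprod_tlift (x y : tcar T) : tprod x y =
  tlift (fun a b => tlift (fun a' b' => tmul T (a * a') (b * b')) y) x.
Proof. by []. Qed.

Lemma tprodA : associative (@tprod k A B T).
Proof.
move=> x y z; apply: (tensor_ext (f := fun x => tprod x (tprod y z))
  (g := fun x => tprod (tprod x y) z)) => [||a b]; [lin|lin|].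
apply: (tensor_ext (f := fun y => tprod (tmul T a b) (tprod y z))
  (g := fun y => tprod (tprod (tmul T a b) y) z)) => [||a' b']; [lin|lin|].
apply: (tensor_ext (f := fun z => tprod (tmul T a b) (tprod (tmul T a' b') z))
  (g := fun z => tprod (tprod (tmul T a b) (tmul T a' b')) z))
  => [||a'' b'']; [lin|lin|].
by rewrite !tprodE !mulrA.
Qed.

Lemma tprodx1 (x : tcar T) : tprod x (tmul T 1 1) = x.
Proof.
apply: (tensor_ext (f := fun x => tprod x (tmul T 1 1)) (g := fun x => x));
  [lin|lin|].
by move=> a b; rewrite tprodE !mulr1.
Qed.

Lemma tprod1x (x : tcar T) : tprod (tmul T 1 1) x = x.
Proof.
apply: (tensor_ext (f := tprod (tmul T 1 1)) (g := fun x => x)); [lin|lin|].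
by move=> a b; rewrite tprodE !mul1r.
Qed.

End TensorAlgebra.

Section TensorSpan.
Variables (k : fieldType) (U V : lmodType k) (T : tensor U V).
Variables (P : U -> Prop) (Q : V -> Prop).

Lemma in_tspan0 : in_tspan (T := T) P Q 0.
Proof. by exists [::]; rewrite big_nil. Qed.

Lemma in_tspan_tmul u v : P u -> Q v -> in_tspan P Q (tmul T u v).
Proof.
move=> Pu Qv; exists [:: (u, v)]; split; last by rewrite big_seq1.
by move=> p; rewrite inE => /eqP->.
Qed.

Lemma in_tspanD (x y : tcar T) :
  in_tspan P Q x -> in_tspan P Q y -> in_tspan P Q (x + y).
Proof.
move=> [s [Hs ->]] [t [Ht ->]]; exists (s ++ t); split; last by rewrite big_cat.
by move=> p; rewrite mem_cat => /orP[/Hs|/Ht].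
Qed.

Lemma in_tspan_sum (I : eqType) (r : seq I) (F : I -> tcar T) :
  (forall i, i \in r -> in_tspan P Q (F i)) -> in_tspan P Q (\sum_(i <- r) F i).
Proof.
move=> HF; rewrite big_seq; apply: big_ind => //; first exact: in_tspan0.
by move=> x y; apply: in_tspanD.
Qed.

Lemma in_tspanZ c (x : tcar T) : (forall u, P u -> P (c *: u)) ->
  in_tspan P Q x -> in_tspan P Q (c *: x).
Proof.
move=> HP [s [Hs ->]]; rewrite scaler_sumr; apply: in_tspan_sum => p /Hs[Pp Qp].
rewrite -(linear_propZ (f := fun u => tmul T u p.2)); last lin.
by apply: in_tspan_tmul => //; apply: HP.
Qed.

End TensorSpan.

Lemma in_tspan_linear (k : fieldType) (U V U' V' : lmodType k)
    (T : tensor U V) (T' : tensor U' V') (P : U -> Prop) (Q : V -> Prop)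
    (P' : U' -> Prop) (Q' : V' -> Prop) (h : tcar T -> tcar T') (x : tcar T) :
  linear h -> (forall u v, P u -> Q v -> in_tspan P' Q' (h (tmul T u v))) ->
  in_tspan P Q x -> in_tspan P' Q' (h x).
Proof.
move=> Hh HPQ [s [Hs ->]]; rewrite (linear_prop_sum Hh).
by apply: in_tspan_sum => p /Hs[]; apply: HPQ.
Qed.

(** * Sweedler calculus and the antipode *)

Section Antipode.
Variables (k : fieldType) (K : algType k).
Variables (TKK : tensor K K) (TKKK : tensor (tcar TKK) K).
Variables (Delta : K -> tcar TKK) (eps : K -> k) (S : K -> K).
Hypothesis hopfK : is_hopf TKKK Delta eps S.

Local Notation sweedler phi a := (tlift (t := TKK) phi (Delta a)).

Lemma Delta_linear : linear Delta.
Proof. by case: hopfK => [[]]. Qed.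

Lemma Delta1 : Delta 1 = tmul TKK 1 1.
Proof. by case: hopfK => [[? []]]. Qed.

Lemma DeltaM a b : Delta (a * b) = tprod (Delta a) (Delta b).
Proof. by case: hopfK => [[? []]]. Qed.

Lemma eps_scalar : scalar eps.
Proof. by case: hopfK => ? []. Qed.

Lemma eps1 : eps 1 = 1.
Proof. by case: hopfK => ? [? []]. Qed.

Lemma epsM a b : eps (a * b) = eps a * eps b.
Proof. by case: hopfK => ? [? []]. Qed.

Lemma antipode_linear : linear S.
Proof. by case: hopfK => ? ? ? ? []. Qed.

Lemma antipodeVl a : sweedler (fun u v => S u * v) a = (eps a)%:A.
Proof. by case: hopfK => ? ? ? ? [_ /(_ a)[]]. Qed.

Lemma antipodeVr a : sweedler (fun u v => u * S v) a = (eps a)%:A.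
Proof. by case: hopfK => ? ? ? ? [_ /(_ a)[]]. Qed.

#[local] Hint Resolve Delta_linear eps_scalar antipode_linear : core.

Lemma counitl (X : lmodType k) (h : K -> X) a : linear h ->
  sweedler (fun u v => eps u *: h v) a = h a.
Proof.
move=> Hh; have [_ _ _ /(_ a)[e _] _] := hopfK; rewrite -{2}e tlift_comp; [|lin|lin].
by apply: eq_tlift => [|u v]; [lin|rewrite (linear_propZ Hh)].
Qed.

Lemma counitr (X : lmodType k) (h : K -> X) a : linear h ->
  sweedler (fun u v => eps v *: h u) a = h a.
Proof.
move=> Hh; have [_ _ _ /(_ a)[_ e] _] := hopfK; rewrite -{2}e tlift_comp; [|lin|lin].
by apply: eq_tlift => [|u v]; [lin|rewrite (linear_propZ Hh)].
Qed.

(** The axiom is an equality in the threefold tensor product; it is transported to [X] along the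
    linear map [g] induced by the trilinear [Phi]. *)
Lemma coassoc (X : lmodType k) (Phi : K -> K -> K -> X) a :
  (forall v w, linear (fun u => Phi u v w)) ->
  (forall u w, linear (fun v => Phi u v w)) ->
  (forall u v, linear (fun w => Phi u v w)) ->
  sweedler (fun u v => sweedler (fun u1 u2 => Phi u1 u2 v) u) a =
  sweedler (fun u v => sweedler (fun v1 v2 => Phi u v1 v2) v) a.
Proof.
move=> H1 H2 H3.
pose g := tlift (t := TKKK)
  (fun w v => tlift (t := TKK) (fun u1 u2 => Phi u1 u2 v) w).
have gE w v : g (tmul TKKK w v) = tlift (fun u1 u2 => Phi u1 u2 v) w.
  by rewrite /g tliftE //; lin.
have Hg : linear g by rewrite /g; lin.
have [_ _ /(_ a)/(congr1 g) e _ _] := hopfK; move: e.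
rewrite /Delta_id /id_Delta !(tlift_comp _ Hg); [|lin|lin] => e.
transitivity (sweedler (fun u v => g (tmul TKKK (Delta u) v)) a).
  by apply: eq_tlift => *; [lin|rewrite gE].
rewrite e; apply: eq_tlift => [|u v]; first lin.
rewrite (tlift_comp _ Hg); last lin.
by apply: eq_tlift => *; [lin|rewrite gE tliftE //; lin].
Qed.

Lemma sweedlerM (X : lmodType k) (phi : K -> K -> X) a b : Defs.bilinear phi ->
  sweedler phi (a * b) =
  sweedler (fun u v => sweedler (fun u' v' => phi (u * u') (v * v')) b) a.
Proof.
move=> [Hr Hl]; have Hphi := tlift_linear (T := TKK) (conj Hr Hl).
rewrite DeltaM tprod_tlift (tlift_comp _ Hphi); last lin.
apply: eq_tlift => [|u v]; first lin.
rewrite (tlift_comp _ Hphi); last lin.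
by apply: eq_tlift => *; [lin|rewrite tliftE].
Qed.

(* The product is an argument because [F] also takes values in the tensor
   square of [K], which carries no algebra structure here. *)
Lemma convolution_cancel (A : lmodType k) (op : A -> A -> A)
    (F M G : K -> A) (c e : A) :
  (forall x, linear (op x)) -> (forall y, linear (fun x => op x y)) ->
  associative op -> (forall x, op x e = x) ->
  linear F -> linear M -> linear G ->
  (forall a, sweedler (fun u v => op (F u) (M v)) a = eps a *: c) ->
  (forall a, sweedler (fun u v => op (M u) (G v)) a = eps a *: e) ->
  forall a, F a = op c (G a).
Proof.
move=> Hr Hl opA op1 HF HM HG FM MG a.
(* The two bracketings of the convolution product of [F], [M] and [G] are compared: [M] with [G]
   collapses to the counit times [e], leaving [F]; [F] with [M] collapses to the counit times [c],
   leaving [op c (G a)]. *)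
rewrite -(counitr a HF) -(counitl a HG) (tlift_comp _ (Hr c)); last lin.
transitivity (sweedler (fun u v =>
    sweedler (fun v1 v2 => op (F u) (op (M v1) (G v2))) v) a).
  apply: eq_tlift => [|u v]; first lin.
  rewrite -(tlift_comp (h := op (F u))) //; last lin.
  by rewrite MG (linear_propZ (Hr _)) op1.
rewrite -(@coassoc _ (fun u v w => op (F u) (op (M v) (G w)))); [|lin|lin|lin].
apply: eq_tlift => [|u v]; first lin.
transitivity (sweedler (fun u1 u2 => op (op (F u1) (M u2)) (G v)) u).
  by apply: eq_tlift => *; [lin|rewrite opA].
rewrite -(tlift_comp (h := fun x => op x (G v))) //; last lin.
by rewrite FM (linear_propZ (Hl _)) (linear_propZ (Hr _)).
Qed.

(** [S] is a right convolution inverse of the identity, so convolving [F] with the identity can be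
    undone. *)
Lemma convolution_id_cancel (F : K -> K) (c : K) : linear F ->
  (forall a, sweedler (fun u v => F u * v) a = eps a *: c) ->
  forall a, F a = c * S a.
Proof.
move=> HF Fc; apply: (@convolution_cancel _ *%R F id S c 1) => //.
- by move=> x; lin.
- by move=> y; lin.
- exact: mulrA.
- exact: mulr1.
- exact: antipodeVr.
Qed.

(** The factors are cancelled one at a time: first [b] in [S(a_1 b) a_2], which gives [step], then
    [a] in [S (a * b)]. Only convolution with the identity of [K] occurs. *)
Lemma antipodeM a b : S (a * b) = S b * S a.
Proof.
have step a' b' : sweedler (fun u v => S (u * b') * v) a' = eps a' *: S b'.
  transitivity ((eps a')%:A * S b'); last by rewrite -scalerAl mul1r.
  apply: (@convolution_id_cancel
    (fun b => sweedler (fun u v => S (u * b) * v) a')) => [|b'']; first lin.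
  transitivity (sweedler (fun u v => S u * v) (a' * b'')); last first.
    by rewrite antipodeVl epsM mulrC scalerA.
  rewrite sweedlerM; last lin.
  rewrite tlift_exchange; [|lin|lin|lin|lin].
  apply: eq_tlift => [|u' v']; first lin.
  rewrite (tlift_comp (h := fun x => x * v')); [|lin|lin].
  by apply: eq_tlift => *; [lin|rewrite mulrA].
by apply: (@convolution_id_cancel (fun a => S (a * b))) => [|a']; [lin|].
Qed.

Lemma antipode1 : S 1 = 1.
Proof.
have := antipodeVl 1; rewrite Delta1 tliftE; last lin.
by rewrite mulr1 eps1 scale1r.
Qed.

Lemma eps_antipode a : eps (S a) = eps a.
Proof.
(* Scalars are compared as multiples of [1] in [K], so that [eps] can be applied to the antipode
   axiom by a linear map [K -> K]. *)
suff /eqP : (eps a)%:A = (eps (S a))%:A :> K.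
  by rewrite -subr_eq0 -scalerBl scaler_eq0 oner_eq0 orbF subr_eq0 => /eqP.
have Heps : linear (fun x => (eps x)%:A : K) by lin.
rewrite -(@counitr _ (fun u => (eps (S u))%:A) a); last lin.
have epsA (c : k) : eps c%:A = c.
  by have := eps_scalar c 1 0; rewrite /= addr0 => ->; rewrite eps1 mulr1
    (@linear_prop0 _ _ (k^o)) ?addr0.
rewrite -[in LHS](epsA (eps a)) -(antipodeVl a).
rewrite (tlift_comp (h := fun x => (eps x)%:A : K)) //; last lin.
by apply: eq_tlift => [|u v]; [lin|rewrite epsM scalerA mulrC].
Qed.

(** In the convolution product of maps from [K] to its tensor square, the left side is a left
    inverse of [Delta] and the right side a right inverse, so they agree. *)
Lemma Delta_antipode a :
  Delta (S a) = sweedler (fun u v => tmul TKK (S v) (S u)) a.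
Proof.
rewrite -[RHS]tprod1x.
apply: (@convolution_cancel _ (@tprod k K K TKK) (fun x => Delta (S x)) Delta
  (fun a => sweedler (fun u v => tmul TKK (S v) (S u)) a) _ (tmul TKK 1 1)).
- by move=> x; lin.
- by move=> x; lin.
- exact: tprodA.
- exact: tprodx1.
- lin.
- lin.
- lin.
- move=> b; rewrite -Delta1 -(linear_propZ Delta_linear) -antipodeVl.
  rewrite (tlift_comp _ Delta_linear); last lin.
  by apply: eq_tlift => [|u v]; [lin|rewrite DeltaM].
move=> b.
(* In Sweedler notation, [u_1 (x) u_2 S(u_3) = u (x) 1]. It removes the inner pair of
   [b_1 S(b_4) (x) b_2 S(b_3)], leaving [b_1 S(b_2) (x) 1]. *)
have cancel_last u : sweedler (fun u1 u2 =>
    tprod (Delta u1) (tmul TKK 1 (S u2))) u = tmul TKK u 1.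
  transitivity (sweedler (fun u v =>
      sweedler (fun u1 u2 => tmul TKK u1 (u2 * S v)) u) u).
    apply: eq_tlift => [|u1 u2]; first lin.
    rewrite tprod_tlift; apply: eq_tlift => [|x y]; first lin.
    by rewrite tliftE ?mulr1 //; lin.
  rewrite (@coassoc _ (fun u v w => tmul TKK u (v * S w))); [|lin|lin|lin].
  rewrite -[RHS](@counitr _ (fun u => tmul TKK u 1) u); last lin.
  apply: eq_tlift => [|u1 u2]; first lin.
  rewrite -(tlift_comp (h := tmul TKK u1)); [|lin|lin].
  by rewrite antipodeVr; apply: linear_propZ; lin.
transitivity (sweedler (fun u v => sweedler (fun v1 v2 =>
    tprod (Delta u) (tmul TKK (S v2) (S v1))) v) b).
  apply: eq_tlift => [|u v]; first lin.
  by rewrite (tlift_comp (h := tprod (Delta u))) //; lin.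
rewrite -(@coassoc _ (fun u v w => tprod (Delta u) (tmul TKK (S w) (S v))));
  [|lin|lin|lin].
transitivity (sweedler (fun u v => tmul TKK (u * S v) 1) b).
  apply: eq_tlift => [|u v]; first lin.
  transitivity (tprod (tmul TKK u 1) (tmul TKK (S v) 1)); last first.
    by rewrite tprodE mulr1.
  rewrite -cancel_last (tlift_comp (h := fun x => tprod x _)); [|lin|lin].
  apply: eq_tlift => [|u1 u2]; first lin.
  by rewrite -tprodA tprodE mul1r mulr1.
rewrite -(tlift_comp (h := fun x => tmul TKK x 1)); [|lin|lin].
by rewrite antipodeVr; apply: (linear_propZ (f := fun x => tmul TKK x 1)); lin.
Qed.

Lemma Delta_antipode2 a : Delta (S (S a)) =
  sweedler (fun u v => tmul TKK (S (S u)) (S (S v))) a.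
Proof.
rewrite !Delta_antipode (tlift_comp (h := tlift _)); [|lin|lin].
by apply: eq_tlift => [|u v]; [lin|rewrite tliftE //; lin].
Qed.

(** A bialgebra endomorphism respects the antipode, because [eta] after [S] and [S] after [eta] are
    a left and a right convolution inverse of [eta]. *)
Lemma hopf_endo_antipode eta : hopf_endo Delta eps eta ->
  forall a, eta (S a) = S (eta a).
Proof.
move=> [Heta eta1 etaM etaD etae] a; rewrite -[RHS]mul1r.
apply: (@convolution_cancel _ *%R (fun x => eta (S x)) eta
  (fun x => S (eta x)) 1 1).
- by move=> x; lin.
- by move=> x; lin.
- exact: mulrA.
- exact: mulr1.
- lin.
- lin.
- lin.
- move=> b; transitivity (eta (eps b)%:A); last first.
    by rewrite (linear_propZ Heta) eta1.
  rewrite -antipodeVl.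
  rewrite (tlift_comp _ Heta); last lin.
  by apply: eq_tlift => [|u v]; [lin|rewrite etaM].
move=> b; rewrite -etae -antipodeVr etaD /tmap (tlift_comp (h := tlift _));
  [|lin|lin].
by apply: eq_tlift => [|u v]; [lin|rewrite tliftE //; lin].
Qed.

Section ConjugateAntipodeSquare.
Variables D Dinv : K.
Hypotheses (DVD : Dinv * D = 1) (DDV : D * Dinv = 1).
Hypotheses (DeltaD : Delta D = tmul TKK D D) (epsD : eps D = 1).

Lemma Delta_inv_grouplike : Delta Dinv = tmul TKK Dinv Dinv.
Proof.
rewrite -[LHS]tprodx1 -{1}DDV -[X in tmul _ _ X]DDV -tprodE tprodA -DeltaD.
by rewrite -DeltaM DVD Delta1 tprod1x.
Qed.

(** [S] reverses products and coproducts, so its square preserves both; conjugation by an invertible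
    grouplike element is a bialgebra map. *)
Lemma hopf_endo_conj_antipode2 :
  hopf_endo Delta eps (fun x => Dinv * S (S x) * D).
Proof.
split=> [||a b|a|a].
- lin.
- by rewrite !antipode1 mulr1.
- rewrite !antipodeM !mulrA; congr (_ * _); rewrite -!mulrA; congr (_ * (_ * _)).
  by rewrite !mulrA DDV mul1r.
- rewrite !DeltaM Delta_inv_grouplike DeltaD Delta_antipode2 /tmap.
  rewrite (tlift_comp (h := fun x => tprod (tprod _ x) _)); [|lin|lin].
  by apply: eq_tlift => [|u v]; [lin|rewrite !tprodE].
- have epsDV : eps Dinv = 1 by rewrite -[LHS]mulr1 -epsD -epsM DVD eps1.
  by rewrite !epsM !eps_antipode epsD epsDV mulr1 mul1r.
Qed.

End ConjugateAntipodeSquare.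

(** * Matrices of coefficients and the Hopf subalgebra they generate *)

Section ComatrixCoefficients.
Variables (n : nat) (y : 'I_n -> 'I_n -> K).
Hypothesis Delta_y : forall i j, Delta (y i j) = \sum_s tmul TKK (y i s) (y s j).
Hypothesis eps_y : forall i j, eps (y i j) = (i == j)%:R.

(** The Hopf subalgebra generated by the [y i j], given inductively so that claims about its
    elements follow by induction on their generation. Closure under [Delta] is derived from
    [Delta_y]. *)
Inductive hopf_gen : K -> Prop :=
| hopf_gen0 : hopf_gen 0
| hopf_gen_lin c u v : hopf_gen u -> hopf_gen v -> hopf_gen (c *: u + v)
| hopf_gen1 : hopf_gen 1
| hopf_genM u v : hopf_gen u -> hopf_gen v -> hopf_gen (u * v)
| hopf_gen_coef i j : hopf_gen (y i j)
| hopf_genS u : hopf_gen u -> hopf_gen (S u).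

Lemma hopf_genZ c u : hopf_gen u -> hopf_gen (c *: u).
Proof. by move=> Hu; rewrite -[_ *: _]addr0; apply: hopf_gen_lin => //; apply: hopf_gen0. Qed.

Lemma hopf_gen_hopf_subalg : hopf_subalg Delta S hopf_gen.
Proof.
split; try by constructor.
- by split; constructor.
move=> x; elim=> {x} [|c u v _ IHu _ IHv||u v _ IHu _ IHv|i j|u _ IHu].
- by rewrite (linear_prop0 Delta_linear); apply: in_tspan0.
- rewrite Delta_linear; apply: in_tspanD IHv.
  by apply: in_tspanZ IHu; apply: hopf_genZ.
- by rewrite Delta1; apply: in_tspan_tmul; apply: hopf_gen1.
- rewrite DeltaM.
  apply: (in_tspan_linear (h := fun x => tprod x (Delta v))) IHu; first lin.
  move=> a b Ha Hb; apply: (in_tspan_linear (h := tprod _)) IHv; first lin.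
  by move=> a' b' Ha' Hb'; rewrite tprodE; apply: in_tspan_tmul; apply: hopf_genM.
- rewrite Delta_y; apply: in_tspan_sum => s _.
  by apply: in_tspan_tmul; apply: hopf_gen_coef.
- rewrite Delta_antipode.
  apply: (in_tspan_linear (h := tlift _)) IHu; first lin.
  move=> a b Ha Hb; rewrite tliftE; last lin.
  by apply: in_tspan_tmul; apply: hopf_genS.
Qed.

(** The antipode axiom at [y i j]; with the next lemma it makes [S(Y)] a two-sided inverse of
    [Y]. *)
Lemma antipode_coefVl i j : \sum_s S (y i s) * y s j = (i == j)%:R.
Proof.
have := antipodeVl (y i j); rewrite Delta_y eps_y.
rewrite (linear_prop_sum (tlift_linear _)); last lin.
rewrite scaler_nat => <-; apply: eq_bigr => s _; rewrite tliftE //; lin.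
Qed.

Lemma antipode_coefVr i j : \sum_s y i s * S (y s j) = (i == j)%:R.
Proof.
have := antipodeVr (y i j); rewrite Delta_y eps_y.
rewrite (linear_prop_sum (tlift_linear _)); last lin.
rewrite scaler_nat => <-; apply: eq_bigr => s _; rewrite tliftE //; lin.
Qed.

Lemma sum_mul_delta (f : 'I_n -> K) i (x : K) :
  \sum_j f j * ((j == i)%:R * x) = f i * x.
Proof.
rewrite (bigD1 i) //= eqxx mul1r big1 ?addr0 // => j /negPf->.
by rewrite mul0r mulr0.
Qed.

(* With matrices: [Y W^T = D] gives [W^T = S(Y) D], so the second relation says
   that [D Y' D^-1] is the transpose-inverse of [S(Y)], which is [S^2(Y)]. *)
Lemma antipode2_coef (D Dinv : K) (w Y' : 'I_n -> 'I_n -> K) :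
  Dinv * D = 1 ->
  (forall i j, \sum_s y i s * w j s = (i == j)%:R * D) ->
  (forall i j, \sum_s w j s * Y' i s = (i == j)%:R * D) ->
  forall i j, Y' i j = Dinv * S (S (y i j)) * D.
Proof.
move=> DVD yw wY i r.
(* The relation [Y W^T = D] is multiplied on the left by [S(Y)]. *)
have wE j t : w j t = S (y t j) * D.
  transitivity (\sum_s (t == s)%:R * w j s).
    rewrite (bigD1 t) //= eqxx mul1r big1 ?addr0 // => s.
    by rewrite eq_sym => /negPf->; rewrite mul0r.
  rewrite -(sum_mul_delta (fun i' => S (y t i'))).
  under [RHS]eq_bigr do rewrite -yw mulr_sumr.
  rewrite exchange_big /=; apply: eq_bigr => s _.
  by rewrite -antipode_coefVl mulr_suml; apply: eq_bigr => i' _; rewrite mulrA.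
(* [S] applied to [Y S(Y) = 1]; since it reverses products, the result is a product of
   transposes. *)
have SSS s : \sum_j S (S (y j r)) * S (y s j) = (s == r)%:R.
  have S0 : S 0 = 0 := linear_prop0 antipode_linear.
  transitivity (S (s == r)%:R); last by case: eqP; rewrite ?antipode1.
  rewrite -antipode_coefVr (linear_prop_sum antipode_linear).
  by apply: eq_bigr => j _; rewrite antipodeM.
suff DY : D * Y' i r = S (S (y i r)) * D by rewrite -mulrA -DY mulrA DVD mul1r.
rewrite -(sum_mul_delta (fun j => S (S (y j r)))).
under [RHS]eq_bigr => j _ do rewrite eq_sym -wY mulr_sumr.
rewrite exchange_big /=.
transitivity (\sum_s (s == r)%:R * (D * Y' i s)).
  rewrite (bigD1 r) //= eqxx mul1r big1 ?addr0 // => s /negPf->.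
  by rewrite mul0r.
apply: eq_bigr => s _; rewrite -SSS mulr_suml; apply: eq_bigr => j _.
by rewrite wE !mulrA.
Qed.

End ComatrixCoefficients.
End Antipode.

(** * Coefficients of a coaction *)

Section Coaction.
Variables (k : fieldType) (K : algType k) (E : falgType k).
Variables (TKK : tensor K K) (TKKK : tensor (tcar TKK) K).
Variables (TKE : tensor K E) (TKKE : tensor (tcar TKK) E).
Variables (Delta : K -> tcar TKK) (eps : K -> k) (S : K -> K).
Variable rho : E -> tcar TKE.
Hypothesis hopfK : is_hopf TKKK Delta eps S.
Hypothesis comodE : comodule_algebra TKKE Delta eps rho.

Let Delta_lin : linear Delta := Delta_linear hopfK.
Let eps_lin : scalar eps := eps_scalar hopfK.

Lemma rho_linear : linear rho.
Proof. by case: comodE. Qed.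

#[local] Hint Resolve Delta_lin eps_lin rho_linear : core.

Section CoactionMatrix.
Variables (n : nat) (X : n.-tuple E) (y : 'I_n -> 'I_n -> K).
Hypothesis freeX : free X.
Hypothesis rhoX : forall i,
  rho (tnth X i) = \sum_s tmul TKE (y i s) (tnth X s).

Lemma coord_scalar j : scalar (coord X j).
Proof. by move=> c u v; rewrite linearP. Qed.

Lemma coord_tnth i j : coord X j (tnth X i) = (i == j)%:R.
Proof. by rewrite (tnth_nth 0) coord_free. Qed.

#[local] Hint Resolve coord_scalar : core.

Lemma sum_coord (V : lmodType k) (f : 'I_n -> V) j :
  \sum_s coord X j (tnth X s) *: f s = f j.
Proof.
rewrite (bigD1 j) //= coord_tnth eqxx scale1r big1 ?addr0 // => s /negPf sj.
by rewrite coord_tnth sj scale0r.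
Qed.

(** Contracting with a coordinate function recovers the coefficient, so the coefficients of [rho] on
    a free family are unique. *)
Lemma coef_coord i j : tlift (fun u e => coord X j e *: u) (rho (tnth X i)) = y i j.
Proof.
rewrite rhoX (linear_prop_sum (tlift_linear _)); last lin.
rewrite -[RHS](sum_coord (y i)); apply: eq_bigr => s _.
by rewrite tliftE //; lin.
Qed.

(** Coassociativity of [rho] at the [i]-th vector, with the last tensor factor contracted by the
    [j]-th coordinate through [g]. *)
Lemma Delta_coef i j : Delta (y i j) = \sum_s tmul TKK (y i s) (y s j).
Proof.
pose g := tlift (t := TKKE) (fun w e => coord X j e *: w).
have gE w e : g (tmul TKKE w e) = coord X j e *: w.
  by rewrite /g tliftE //; lin.
have Hg : linear g by rewrite /g; lin.
have [_ _ _ /(_ (tnth X i))/(congr1 g) coassE _] := comodE; move: coassE.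
rewrite rhoX !(linear_prop_sum (tlift_linear _)); [|lin|lin].
rewrite !(linear_prop_sum Hg); under eq_bigr => s _.
  rewrite tliftE; last lin.
  rewrite gE; over.
rewrite sum_coord => ->; apply: eq_bigr => s _.
rewrite tliftE; last lin.
rewrite rhoX (linear_prop_sum (tlift_linear _)); last lin.
rewrite (linear_prop_sum Hg); under eq_bigr => t _.
  rewrite tliftE; last lin.
  rewrite gE; over.
exact: sum_coord.
Qed.

Lemma eps_coef i j : eps (y i j) = (i == j)%:R.
Proof.
have [_ _ _ _ /(_ (tnth X i))/(congr1 (coord X j))] := comodE.
rewrite coord_tnth rhoX (linear_prop_sum (tlift_linear _)); last lin.
move=> <-; rewrite linear_sum /=.
rewrite -[LHS](sum_coord (V := k^o) (fun s => eps (y i s)) j).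
apply: eq_bigr => s _; rewrite tliftE; last lin.
by rewrite linearZ /= mulrC.
Qed.

End CoactionMatrix.

(** The line of [fe] is a subcomodule whose coefficient matrix is the 1 by 1 matrix [D]. *)
Lemma grouplike_codet (fe : E) (D : K) : fe != 0 -> rho fe = tmul TKE D fe ->
  Delta D = tmul TKK D D /\ eps D = 1.
Proof.
move=> fe0 rhofe.
have freefe : free [tuple fe] by rewrite seq1_free.
have rhoX i : rho (tnth [tuple fe] i) =
    \sum_(s < 1) tmul TKE D (tnth [tuple fe] s).
  by rewrite big_ord1 ord1 !tnth0.
split; first by rewrite (Delta_coef freefe rhoX ord0 ord0) big_ord1.
exact: (eps_coef freefe rhoX ord0 ord0).
Qed.

Lemma rhoM_tlift (V : lmodType k) (phi : K -> E -> V) a b : Defs.bilinear phi ->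
  tlift phi (rho (a * b)) =
  tlift (fun u e => tlift (fun u' e' => phi (u * u') (e * e')) (rho b)) (rho a).
Proof.
move=> [Hr Hl]; have Hphi := tlift_linear (T := TKE) (conj Hr Hl).
have [_ _ -> _ _] := comodE.
rewrite tprod_tlift (tlift_comp _ Hphi); last lin.
apply: eq_tlift => [|u v]; first lin.
rewrite (tlift_comp _ Hphi); last lin.
by apply: eq_tlift => *; [lin|rewrite tliftE].
Qed.

End Coaction.

(** * Dual families and invertibility of the Nakayama matrix *)

Lemma free_row_eq0 (k : fieldType) (E : vectType k) (n : nat) (a : n.-tuple E)
    (v : 'rV[k]_n) :
  free a -> \sum_i v 0 i *: tnth a i = 0 -> v = 0.
Proof.
move=> freea v0; apply/rowP => i; rewrite mxE.
apply: (elimT freeP freea (v 0)); rewrite -[RHS]v0.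
by apply: eq_bigr => j _; rewrite (tnth_nth 0).
Qed.

Lemma free_dual_family (k : fieldType) (E : vectType k) (form : E -> E -> k)
    (n : nat) (a : n.-tuple E) :
  (forall x, scalar (form x)) -> (forall y, scalar (fun x => form x y)) ->
  (forall x, (forall y, form x y = 0) -> x = 0) -> free a ->
  exists b : 'I_n -> E, forall i j, form (tnth a i) (b j) = (i == j)%:R.
Proof.
move=> Hr Hl nondeg freea.
have sumr x := linear_prop_sum (V := k^o) (Hr x).
have suml y := linear_prop_sum (V := k^o) (Hl y).
have scaler x := linear_propZ (V := k^o) (Hr x).
have scalel y := linear_propZ (V := k^o) (Hl y).
pose e := vbasis (fullv : {vspace E}).
pose M := \matrix_(t, i) form (tnth a i) (tnth e t).
(* Nondegeneracy makes the columns of [M] independent; the rows of a left inverse [B] are the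
   coordinates of the dual vectors. *)
have /row_fullP[B BM] : row_full M.
  rewrite /row_full -mxrank_tr; apply: inj_row_free => v vM.
  have v0 : \sum_i v 0 i *: tnth a i = 0.
    apply: nondeg => z; rewrite (coord_vbasis (memvf z)) sumr big1 // => t _.
    rewrite scaler; suff -> : form (\sum_i v 0 i *: tnth a i) e`_t = 0.
      by rewrite scaler0.
    have := congr1 (fun A : 'rV_ _ => A 0 t) vM; rewrite !mxE => <-.
    rewrite suml; apply: eq_bigr => i _.
    by rewrite scalel !mxE (tnth_nth 0 e).
  exact: free_row_eq0 freea v0.
exists (fun j => \sum_t B j t *: tnth e t) => i j.
have := congr1 (fun A : 'M_n => A j i) BM; rewrite !mxE eq_sym => <-.
by rewrite sumr; apply: eq_bigr => t _; rewrite scaler mxE.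
Qed.

Lemma linear_inj_unitmx (k : fieldType) (E : vectType k) (mu : E -> E)
    (n : nat) (a : n.-tuple E) (alpha : 'M[k]_n) :
  linear mu -> injective mu -> free a ->
  (forall i, mu (tnth a i) = \sum_j alpha i j *: tnth a j) ->
  alpha \in unitmx.
Proof.
move=> Hmu inj freea mua; rewrite -row_free_unit; apply: inj_row_free => v va.
have v0 : \sum_i v 0 i *: tnth a i = 0.
  apply: inj; rewrite (linear_prop0 Hmu) (linear_prop_sum Hmu).
  under eq_bigr => i _ do rewrite (linear_propZ Hmu) mua scaler_sumr.
  rewrite exchange_big /= big1 // => j _.
  under eq_bigr do rewrite scalerA.
  by rewrite -scaler_suml; have := congr1 (fun A : 'rV_ _ => A 0 j) va;
    rewrite !mxE => ->; rewrite scale0r.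
exact: free_row_eq0 freea v0.
Qed.

(** * Contraction of the coaction with the Frobenius form *)

Section Frobenius.
Variables (k : fieldType) (E : falgType k) (Eg : nat -> {vspace E}).
Variables (l : nat) (form : E -> E -> k) (mu : E -> E).
Variables (K : algType k) (TKK : tensor K K) (TKKK : tensor (tcar TKK) K).
Variables (TKE : tensor K E) (TKKE : tensor (tcar TKK) E).
Variables (Delta : K -> tcar TKK) (eps : K -> k) (S : K -> K).
Variables (rho : E -> tcar TKE) (fe : E) (D : K).
Hypotheses (gradE : connected_graded Eg) (frobE : frobenius_form Eg l form).
Hypothesis comodE : comodule_algebra TKKE Delta eps rho.
Hypothesis gradrho : grading_preserving rho Eg.
Hypotheses (Egl : Eg l = <[fe]>%VS) (rhofe : rho fe = tmul TKE D fe).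

Let rho_lin : linear rho := rho_linear comodE.

Lemma form_linearr x : scalar (form x).
Proof. by case: frobE => [[]]. Qed.

Lemma form_linearl y : scalar (fun x => form x y).
Proof. by case: frobE => [[]]. Qed.

#[local] Hint Resolve rho_lin form_linearr form_linearl : core.

(** By linearity [x] is homogeneous. In degree [l] it is a multiple of [fe]; in other degrees both
    sides vanish, as [1] has degree 0 and [rho] preserves degrees. *)
Lemma codet_form x :
  tlift (fun u e => form 1 e *: u) (rho x) = form 1 x *: D.
Proof.
have [[N [_ fullE _]] _ Eg0] := gradE.
have [_ _ _ form0] := frobE.
have Hl : linear (fun x => tlift (fun u e => form 1 e *: u) (rho x)) by lin.
have Hr : linear (fun x => form 1 x *: D) by lin.
have : x \in (\sum_(i < N) Eg i)%VS by rewrite fullE memvf.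
case/memv_sumP=> xs Hxs ->.
rewrite (linear_prop_sum Hl) (linear_prop_sum Hr).
apply: eq_bigr => i _; have {Hxs} := Hxs i isT.
have [-> | il Hx] := eqVneq (i : nat) l.
  rewrite Egl => /vlineP[c ->]; rewrite (linear_propZ Hl) (linear_propZ Hr).
  by rewrite rhofe tliftE //; lin.
have form1 e : e \in Eg i -> form 1 e = 0.
  by move=> He; apply: (form0 0%N i) => //; rewrite Eg0 memv_line.
rewrite form1 // scale0r; have [s [Hs ->]] := gradrho Hx.
rewrite (linear_prop_sum (tlift_linear _)); last lin.
rewrite big_seq big1 // => p /Hs[_ /form1 p0].
by rewrite tliftE ?p0 ?scale0r //; lin.
Qed.

Lemma form1M x y : form 1 (x * y) = form x y.
Proof. by have [_ formA _ _] := frobE; rewrite -formA mul1r. Qed.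

Lemma codet_form_mul x y :
  tlift (fun u e => tlift (fun u' e' => form e e' *: (u * u')) (rho y)) (rho x)
  = form x y *: D.
Proof.
rewrite -form1M -codet_form (rhoM_tlift comodE); last lin.
apply: eq_tlift => [|u e]; first lin.
by apply: eq_tlift => [|u' e']; [lin|rewrite form1M].
Qed.

Section NakayamaMatrix.
Variables (n : nat) (a : n.-tuple E) (y Y' : 'I_n -> 'I_n -> K).
Hypothesis rhoa : forall i,
  rho (tnth a i) = \sum_s tmul TKE (y i s) (tnth a s).
Hypothesis nakE : nakayama Eg form mu.
Hypothesis rhomua : forall i,
  rho (mu (tnth a i)) = \sum_s tmul TKE (Y' i s) (mu (tnth a s)).

Lemma coef_pairing i b :
  \sum_s y i s * tlift (fun u e => form (tnth a s) e *: u) (rho b) =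
  form (tnth a i) b *: D.
Proof.
rewrite -codet_form_mul rhoa (linear_prop_sum (tlift_linear _)); last lin.
apply: eq_bigr => s _; rewrite tliftE; last lin.
rewrite (tlift_comp (h := *%R (y i s))); [|lin|lin].
by apply: eq_tlift => [|u e]; [lin|rewrite scalerAr].
Qed.

(** The pairing is rewritten as [form b (mu a_i)], which puts the coefficients of [mu a_i] on the
    right of those of [b]; the Nakayama identity then turns [form e (mu a_s)] back into
    [form a_s e]. *)
Lemma nakayama_coef_pairing i b :
  \sum_s tlift (fun u e => form (tnth a s) e *: u) (rho b) * Y' i s =
  form (tnth a i) b *: D.
Proof.
have [_ _ _ formC] := nakE.
rewrite formC -codet_form_mul tlift_exchange; [|lin|lin|lin|lin].
rewrite rhomua (linear_prop_sum (tlift_linear _)); last lin.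
apply: eq_bigr => s _; rewrite tliftE; last lin.
rewrite (tlift_comp (h := fun x => x * Y' i s)); [|lin|lin].
by apply: eq_tlift => [|u e]; [lin|rewrite formC scalerAl].
Qed.

End NakayamaMatrix.
End Frobenius.

(** * Coaction coefficients under a change of basis *)

Lemma inverse_change_basis (k : fieldType) (E : lmodType k) (n : nat)
    (a b : n.-tuple E) (alpha : 'M[k]_n) :
  alpha \in unitmx -> (forall i, tnth b i = \sum_j alpha i j *: tnth a j) ->
  forall i, tnth a i = \sum_j invmx alpha i j *: tnth b j.
Proof.
move=> Ualpha bE q; under eq_bigr => s _ do rewrite bE scaler_sumr.
rewrite exchange_big /=.
transitivity (\sum_j (q == j)%:R *: tnth a j).
  rewrite (bigD1 q) //= eqxx scale1r big1 ?addr0 // => j.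
  by rewrite eq_sym => /negPf->; rewrite scale0r.
apply: eq_bigr => j _; have := congr1 (fun A : 'M_n => A q j) (mulVmx Ualpha).
rewrite !mxE => <-; rewrite scaler_suml.
by apply: eq_bigr => s _; rewrite scalerA.
Qed.

(** The new matrix is [alpha Y alpha^-1]: [b] is expanded in [a], then after the coaction [a] is
    expanded back in [b]. *)
Lemma coaction_change_basis (k : fieldType) (K : algType k) (E : falgType k)
    (TKE : tensor K E) (rho : E -> tcar TKE) (n : nat) (a b : n.-tuple E)
    (alpha : 'M[k]_n) (y : 'I_n -> 'I_n -> K) :
  linear rho -> alpha \in unitmx ->
  (forall i, tnth b i = \sum_j alpha i j *: tnth a j) ->
  (forall i, rho (tnth a i) = \sum_s tmul TKE (y i s) (tnth a s)) ->
  forall i, rho (tnth b i) = \sum_s tmul TKE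
    (\sum_p \sum_q (alpha i p * invmx alpha q s) *: y p q) (tnth b s).
Proof.
move=> Hrho Ualpha bE rhoa i.
have aE := inverse_change_basis Ualpha bE.
have Zl c u e : tmul TKE (c *: u) e = c *: tmul TKE u e.
  by apply: (linear_propZ (f := fun u => tmul TKE u e)); lin.
have Zr c u e : tmul TKE u (c *: e) = c *: tmul TKE u e.
  by apply: (linear_propZ (f := tmul TKE u)); lin.
rewrite {1}bE (linear_prop_sum Hrho).
under [RHS]eq_bigr => s _.
  rewrite (linear_prop_sum (f := fun u => tmul TKE u (tnth b s))); last lin.
  over.
rewrite exchange_big /=; apply: eq_bigr => p _.
rewrite (linear_propZ Hrho) rhoa scaler_sumr.
under [RHS]eq_bigr => s _.
  rewrite (linear_prop_sum (f := fun u => tmul TKE u (tnth b s))); last lin.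
  over.
rewrite exchange_big /=; apply: eq_bigr => q _.
rewrite {1}aE (linear_prop_sum (f := tmul TKE (y p q))); last lin.
by rewrite scaler_sumr; apply: eq_bigr => s _; rewrite Zl Zr scalerA.
Qed.

(** * Inner-faithfulness as generation by coefficients *)

Section Generation.
Variables (k : fieldType) (K : algType k) (E : falgType k) (E1 : {vspace E}).
Variables (TKK : tensor K K) (TKKK : tensor (tcar TKK) K).
Variables (TKE : tensor K E) (TKKE : tensor (tcar TKK) E).
Variables (Delta : K -> tcar TKK) (eps : K -> k) (S : K -> K).
Variable rho : E -> tcar TKE.
Variables (n : nat) (a : n.-tuple E) (y : 'I_n -> 'I_n -> K).

(** An element outside the generated Hopf subalgebra would make it proper, although it contains all
    coefficients of [rho] on [E1]. *)
Lemma hopf_gen_full :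
  is_hopf TKKK Delta eps S -> comodule_algebra TKKE Delta eps rho ->
  inner_faithful_E1 Delta S rho E1 -> basis_of E1 a ->
  (forall i, rho (tnth a i) = \sum_s tmul TKE (y i s) (tnth a s)) ->
  forall x, hopf_gen S y x.
Proof.
move=> hopfK comodE faithful basisa rhoa x; apply: NNPP => Hx.
have freea := basis_free basisa.
have Hy := hopf_gen_hopf_subalg hopfK (Delta_coef hopfK comodE freea rhoa).
apply: (faithful _ Hy); first by exists x.
move=> e He; rewrite (coord_basis basisa He).
rewrite (linear_prop_sum (rho_linear comodE)); apply: in_tspan_sum => i _.
rewrite (linear_propZ (rho_linear comodE)).
apply: in_tspanZ => [u|]; first exact: hopf_genZ.
rewrite -tnth_nth rhoa; apply: in_tspan_sum => s _.
apply: in_tspan_tmul; first exact: hopf_gen_coef.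
by rewrite (basis_mem basisa) // mem_tnth.
Qed.

End Generation.

Theorem theorem3p2
  (k : fieldType)
  (* the connected graded Frobenius algebra E = (+)_i Eg i *)
  (E : falgType k) (Eg : nat -> {vspace E})
  (l : nat) (form : E -> E -> k) (mu : E -> E)
  (* the Hopf algebra K with chosen tensor products *)
  (K : algType k) (TKK : tensor K K) (TKKK : tensor (tcar TKK) K)
  (TKE : tensor K E) (TKKE : tensor (tcar TKK) E)
  (Delta : K -> tcar TKK) (eps : K -> k) (S : K -> K)
  (rho : E -> tcar TKE)
  (* top-degree element and homological codeterminant *)
  (fe : E) (D Dinv : K)
  (* basis of E_1, Nakayama matrix, coaction coefficients *)
  (n : nat) (a : n.-tuple E) (alpha : 'M[k]_n) (y : 'I_n -> 'I_n -> K) :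
  connected_graded Eg ->
  top_degree Eg l ->
  frobenius_form Eg l form ->
  nakayama Eg form mu ->
  @is_hopf k K TKK TKKK Delta eps S ->
  @comodule_algebra k K E TKK TKE TKKE Delta eps rho ->
  @grading_preserving k K E TKE rho Eg ->
  @inner_faithful_E1 k K E TKK TKE Delta S rho (Eg 1%N) ->
  Eg l = <[fe]>%VS ->
  rho fe = tmul TKE D fe ->
  Dinv * D = 1 -> D * Dinv = 1 ->
  basis_of (Eg 1%N) a ->
  (forall i : 'I_n, mu (tnth a i) = \sum_(j < n) alpha i j *: tnth a j) ->
  (forall i : 'I_n, rho (tnth a i) = \sum_(s < n) tmul TKE (y i s) (tnth a s)) ->
  let conjY (i j : 'I_n) : K :=
    \sum_(p < n) \sum_(q < n) (alpha i p * invmx alpha q j) *: y p q in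
  (exists eta : K -> K,
     [/\ @hopf_endo k K TKK Delta eps eta,
         (forall i j, eta (y i j) = conjY i j),
         (forall eta' : K -> K, @hopf_endo k K TKK Delta eps eta' ->
             (forall i j, eta' (y i j) = conjY i j) -> forall x, eta' x = eta x),
         (forall i j, eta (y i j) = Dinv * S (S (y i j)) * D)
       & (forall x, eta x = Dinv * S (S x) * D)])
  /\ (forall x : K, exists z : K, S z = x).
Proof.
move=> gradE [Egl0 _] frobE nakE hopfK comodE gradrho faithful Egl rhofe DVD DDV.
move=> basisa mua rhoa conjY.
have freea := basis_free basisa.
have fe0 : fe != 0 by apply: contraNneq Egl0 => fe0; rewrite -subv0 Egl fe0 -memvE mem0v.
have [DeltaD epsD] := grouplike_codet hopfK comodE fe0 rhofe.
have Delta_y := Delta_coef hopfK comodE freea rhoa.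
have eps_y := eps_coef hopfK comodE freea rhoa.
have gen := hopf_gen_full hopfK comodE faithful basisa rhoa.
have [[Hmu bijmu] _ _ _] := nakE.
have Ualpha := linear_inj_unitmx Hmu (bij_inj bijmu) freea mua.
have [b ab] : exists b : 'I_n -> E,
    forall i j, form (tnth a i) (b j) = (i == j)%:R.
  by have [[Hr Hl] _ [nondeg _] _] := frobE; apply: free_dual_family freea.
(* The images [mu a_i] are the family obtained from [a] through [alpha], so [rho] has coefficients
   [conjY] on them. *)
pose mua_tuple := [tuple mu (tnth a j) | j < n].
have muaE i : tnth mua_tuple i = \sum_j alpha i j *: tnth a j.
  by rewrite tnth_mktuple mua.
have rhomua i :
    rho (tnth mua_tuple i) = \sum_s tmul TKE (conjY i s) (tnth mua_tuple s).
  exact: coaction_change_basis (rho_linear comodE) Ualpha muaE rhoa i.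
have rhomu i : rho (mu (tnth a i)) =
    \sum_s tmul TKE (conjY i s) (mu (tnth a s)).
  have := rhomua i; rewrite tnth_mktuple => ->.
  by apply: eq_bigr => s _; rewrite tnth_mktuple.
have conjYE i j : conjY i j = Dinv * S (S (y i j)) * D.
  (* [w j s] contracts the coaction of the dual vector [b j] with [a_s]; duality turns both pairing
     lemmas into the matrix relations of [antipode2_coef]. *)
  pose w j s := tlift (fun u e => form (tnth a s) e *: u) (rho (b j)).
  apply: (antipode2_coef hopfK Delta_y eps_y (w := w) DVD) => {i j} i j.
  - rewrite (coef_pairing gradE frobE comodE gradrho Egl rhofe rhoa) ab.
    by rewrite scaler_nat mulr_natl.
  - rewrite (nakayama_coef_pairing gradE frobE comodE gradrho Egl rhofe nakE
      rhomu) ab.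
    by rewrite scaler_nat mulr_natl.
pose eta x := Dinv * S (S x) * D.
have Heta : hopf_endo Delta eps eta.
  exact: (hopf_endo_conj_antipode2 hopfK DVD DDV DeltaD epsD).
have [eta_lin eta1 etaM _ _] := Heta.
have etaS := hopf_endo_antipode hopfK Heta.
have etaY i j : eta (y i j) = conjY i j by rewrite conjYE.
split.
  exists eta; split=> // eta' Heta' eta'Y x.
  have [eta'_lin eta'1 eta'M _ _] := Heta'.
  (* Two endomorphisms that agree on the [y i j] agree on what these generate, since both commute
     with [S]. *)
  elim: (gen x) => {x} [|c u v _ IHu _ IHv||u v _ IHu _ IHv|i j|u _ IHu].
  - by rewrite (linear_prop0 eta'_lin) (linear_prop0 eta_lin).
  - by rewrite eta'_lin eta_lin IHu IHv.
  - by rewrite eta'1 eta1.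
  - by rewrite eta'M etaM IHu IHv.
  - by rewrite eta'Y etaY.
  - by rewrite (hopf_endo_antipode hopfK Heta') etaS IHu.
have eta_surj x : exists z, eta z = x.
  elim: (gen x) => {x} [|c _ _ _ [u <-] _ [v <-]||_ _ _ [u <-] _ [v <-]|i j|_ _ [u <-]].
  - by exists 0; rewrite (linear_prop0 eta_lin).
  - by exists (c *: u + v); rewrite eta_lin.
  - by exists 1.
  - by exists (u * v); rewrite etaM.
  (* The preimage is the entry of [alpha^-1 Y alpha]. Its image is that of [alpha^-1 conjY alpha],
     identified with [y i j] by changing basis back from [mu a] to [a] and comparing
     coefficients. *)
  - exists (\sum_p \sum_q (invmx alpha i p * alpha q j) *: y p q).
    have Uinv : invmx alpha \in unitmx by rewrite unitmx_inv.
    have := coaction_change_basis (rho_linear comodE) Uinv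
      (inverse_change_basis Ualpha muaE) rhomua.
    rewrite invmxK => /(coef_coord freea)/(_ i j).
    rewrite (coef_coord freea rhoa) (linear_prop_sum eta_lin) => ->.
    apply: eq_bigr => p _; rewrite (linear_prop_sum eta_lin).
    by apply: eq_bigr => q _; rewrite (linear_propZ eta_lin) etaY.
  - by exists (S u); rewrite etaS.
(* [eta z = Dinv * x * D] means [S (S z) = x] once the conjugation is undone. *)
move=> x; have [z etaz] := eta_surj (Dinv * x * D); exists (S z).
have := congr1 (fun t => D * t * Dinv) etaz; rewrite /eta !mulrA DDV !mul1r.
by rewrite -!mulrA DDV !mulr1.
Qed.
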